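(* Let $p\ge1$, $m=2p$, let $\{\beta(k)\}_{k\ge0}$ be $p\times m$ matrices with $\beta(k)J\beta(k)^*=I_p$, put $C_k=2K^*\beta(k)^*\beta(k)K-j$, and consider the system $W_{k+1}(\lambda)-W_k(\lambda)=-\frac{i}{\lambda}jC_kW_k(\lambda)$, $W_0=I_m$, on the semiaxis $k\ge0$. Let $\varphi_\infty$ be the unique element of $\bigcap_{N\ge0}\mathcal N(N)$. Then $\varphi_\infty$ is the unique Weyl function of this system on the semiaxis, i.e. the unique $p\times p$ matrix function $\varphi$ holomorphic in $\mathbb C_-$ such that for every $\lambda\in\mathbb C_-$ $$\sum_{k=0}^\infty[i\varphi(\lambda)^*\ \ I_p]\,q(\lambda)^kKW_k(\lambda)^*C_kW_k(\lambda)K^*\begin{bmatrix}-i\varphi(\lambda)\\ I_p\end{bmatrix}<\infty.$$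
   Context: $\mathbb C_-$ is the open lower half-plane; $q(\lambda)=|\lambda|^2(|\lambda|^2+1)^{-1}$; $j=\mathrm{diag}(I_p,-I_p)$, $J=\begin{bmatrix}0&I_p\\ I_p&0\end{bmatrix}$, $K=\frac1{\sqrt2}\begin{bmatrix}I_p&-I_p\\ I_p&I_p\end{bmatrix}$. The series condition means convergence of the series of positive semidefinite matrices. For $N\ge0$ let $\mathcal W(N,\lambda)=\{\mathcal W_{ij}(N,\lambda)\}_{i,j=1}^2=KW_{N+1}(\bar\lambda)^*$ ($p\times p$ blocks), and $\mathcal N(N)$ the set of $p\times p$ matrix functions holomorphic in $\mathbb C_-$ of the form $i(\mathcal W_{21}(N,\cdot)R+\mathcal W_{22}(N,\cdot)Q)(\mathcal W_{11}(N,\cdot)R+\mathcal W_{12}(N,\cdot)Q)^{-1}$, with $R,Q$ $p\times p$ matrix functions meromorphic in $\mathbb C_-$, well defined at $-i$, $R^*R+Q^*Q>0$, $R^*R\le Q^*Q$. (It is known that $\bigcap_N\mathcal N(N)$ consists of exactly one function.) *)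

(* Defs.v *)
(* Complex numbers: R[i] (mathcomp-real-closed)
   over an arbitrary realType R, wrapped as CC R so that MathComp-Analysis'
   topology / normed structures on numFieldTypes are found. *)
From HB Require Import structures.
From mathcomp Require Import all_boot all_order all_algebra.
From mathcomp Require Import all_classical all_reals all_analysis.
From mathcomp.real_closed Require Import complex.
Import Order.TTheory GRing.Theory Num.Theory.
Import numFieldTopology.Exports numFieldNormedType.Exports.
Set Implicit Arguments. Unset Strict Implicit. Unset Printing Implicit Defensive.
Local Open Scope ring_scope.
Local Open Scope classical_set_scope.

Definition CC (R : realType) : numClosedFieldType := R[i].

Section Defs.
Variable R : realType.
Local Notation C := (CC R).

Definition ctr (m n : nat) (A : 'M[C]_(m, n)) : 'M[C]_(n, m) := (map_mx conjc A)^T.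

Definition lhp : set C := [set z | 'Im z < 0].

Definition qf (z : C) : C := `|z| ^+ 2 / (`|z| ^+ 2 + 1).

Variable p : nat.

Definition jm : 'M[C]_(p + p) := block_mx 1%:M 0 0 (- 1%:M).
Definition Jm : 'M[C]_(p + p) := block_mx 0 1%:M 1%:M 0.
Definition Km : 'M[C]_(p + p) := (sqrtC 2)^-1 *: block_mx 1%:M (- 1%:M) 1%:M 1%:M.

Variable beta : nat -> 'M[C]_(p, p + p).

Definition Ck (k : nat) : 'M[C]_(p + p) :=
  2%:R *: (ctr Km *m ctr (beta k) *m beta k *m Km) - jm.

Fixpoint Wk (k : nat) (l : C) : 'M[C]_(p + p) :=
  match k with
  | 0 => 1%:M
  | k'.+1 => Wk k' l - ('i / l) *: (jm *m Ck k' *m Wk k' l)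
  end.

Definition calW (N : nat) (l : C) : 'M[C]_(p + p) := Km *m ctr (Wk N.+1 (conjc l)).
Definition calW11 N l := ulsubmx (calW N l).
Definition calW12 N l := ursubmx (calW N l).
Definition calW21 N l := dlsubmx (calW N l).
Definition calW22 N l := drsubmx (calW N l).

(* positive semidefinite / positive definite (Hermitian forms; in R[i],
   0 <= z means z is real and nonnegative) *)
Definition psd (A : 'M[C]_p) : Prop := forall v : 'cV[C]_p, 0 <= (ctr v *m A *m v) 0 0.
Definition posdef (A : 'M[C]_p) : Prop :=
  forall v : 'cV[C]_p, v != 0 -> 0 < (ctr v *m A *m v) 0 0.

Definition holo_on (D : set C) (f : C -> 'M[C]_p) : Prop :=
  forall z, D z -> derivable (f : C^o -> 'M[C]_p) z 1.

Definition discrete_in (D S : set C) : Prop :=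
  S `<=` D /\ forall z, D z -> \forall w \near z^', ~ S w.

Definition mero_lhp (f : C -> 'M[C]_p) (P : set C) : Prop :=
  [/\ discrete_in lhp P, holo_on (lhp `\` P) f &
      forall s, P s -> exists (n : nat) (M : C),
        \forall z \near s^', `|(z - s) ^+ n *: f z| <= M].

Definition inN (N : nat) (phi : C -> 'M[C]_p) : Prop :=
  holo_on lhp phi /\
  exists (Rf Qf : C -> 'M[C]_p) (PR PQ D : set C),
    [/\ mero_lhp Rf PR /\ mero_lhp Qf PQ, ~ PR (- 'i) /\ ~ PQ (- 'i),
        (forall z, lhp z -> ~ PR z -> ~ PQ z ->
           posdef (ctr (Rf z) *m Rf z + ctr (Qf z) *m Qf z) /\
           psd (ctr (Qf z) *m Qf z - ctr (Rf z) *m Rf z)),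
        discrete_in lhp D &
        forall z, lhp z -> ~ D z ->
          [/\ ~ PR z, ~ PQ z,
              calW11 N z *m Rf z + calW12 N z *m Qf z \in unitmx &
              phi z = 'i *: ((calW21 N z *m Rf z + calW22 N z *m Qf z)
                             *m invmx (calW11 N z *m Rf z + calW12 N z *m Qf z))]].

Definition weyl_term (phi : C -> 'M[C]_p) (l : C) (k : nat) : 'M[C]_p :=
  row_mx ('i *: ctr (phi l)) 1%:M
  *m (qf l ^+ k *: (Km *m ctr (Wk k l) *m Ck k *m Wk k l *m ctr Km))
  *m col_mx (- 'i *: phi l) 1%:M.

Definition weyl_fun (phi : C -> 'M[C]_p) : Prop :=
  holo_on lhp phi /\
  forall l, lhp l -> cvg ((fun n : nat => \sum_(k < n) weyl_term phi l k) @ \oo).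

End Defs.

(* Main.v *)
(* Since [C_k j C_k = j] and [C_k >= j], the energy [q^k f^* W_k^* j W_k f]
   increases with [k], by a positive multiple of the [k]-th term of the Weyl
   series of [f]; so that series is bounded as soon as all energies are
   nonpositive.  For [f = K^* [-i phi; I] v] with [phi] in [N(N)], the reflection
   identity [W_k(l) j W_k(conj l)^* = (1 + l^-2)^k j] rewrites the energy at [N+1]
   as a nonnegative multiple of [|R y|^2 - |Q y|^2 <= 0]; the exceptional points
   of [R], [Q] and of the quotient are reached by continuity.
   Conversely, if [phi] and [psi] are Weyl functions, then
   [f = K^* [-i (phi - psi) v; 0]] has energy 0 at [k = 0] and its terms tend to 0.
   As [C_k >= j], these terms bound the increasing energies, which forces
   [f^* C_0 f <= 0], hence [f = 0]. *)
Require Import Defs.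
From HB Require Import structures.
From mathcomp Require Import all_boot all_order all_algebra.
From mathcomp Require Import all_classical all_reals all_analysis.
From mathcomp.real_closed Require Import complex.
From mathcomp Require Import ring.
Import Order.TTheory GRing.Theory Num.Theory.
Import numFieldTopology.Exports numFieldNormedType.Exports.
Local Open Scope ring_scope.
Local Open Scope classical_set_scope.
Set Implicit Arguments. Unset Strict Implicit. Unset Printing Implicit Defensive.

(** * Scalar identities in the shape left by sesquilinear expansion *)

Lemma parallelogram_identity (F : comPzRingType) (a b c d : F) :
  a + -1 * b + (-1 * c + -1 * (-1 * d)) + (a + b + (c + d)) = 2 * (a + d).
Proof. by ring. Qed.

(** Here [a], [b], [c], [d] stand for the four values of a sesquilinear form on the pairs (x,x),
    (x,y), (y,x), (y,y). The first bracket isolates [b + c], the second contributes [b - c]. *)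
Lemma polar_identity (F : numFieldType) (i a b c d : F) : i * i = -1 ->
  b = 2^-1 * (a + b + (c + d) - a - d
              - i * (a + i * b + (- i * c + - i * (i * d)) - a - d)).
Proof. by move=> h; field: h. Qed.

(** * Hermitian forms *)

Section ConjugateTranspose.
Variable R : realType.
Local Notation C := (CC R).

Lemma ctrE m n (A : 'M[C]_(m, n)) i j : ctr A i j = (A j i)^*.
Proof. by rewrite !mxE. Qed.

Lemma ctrK m n (A : 'M[C]_(m, n)) : ctr (ctr A) = A.
Proof. by apply/matrixP => i j; rewrite !ctrE conjCK. Qed.

Lemma ctrM m n q (A : 'M[C]_(m, n)) (B : 'M[C]_(n, q)) :
  ctr (A *m B) = ctr B *m ctr A.
Proof.
apply/matrixP => i j; rewrite ctrE !mxE rmorph_sum; apply: eq_bigr => k _.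
by rewrite !ctrE rmorphM mulrC.
Qed.

Lemma ctrD m n (A B : 'M[C]_(m, n)) : ctr (A + B) = ctr A + ctr B.
Proof. by apply/matrixP => i j; rewrite !(ctrE, mxE) rmorphD. Qed.

Lemma ctrN m n (A : 'M[C]_(m, n)) : ctr (- A) = - ctr A.
Proof. by apply/matrixP => i j; rewrite !(ctrE, mxE) rmorphN. Qed.

Lemma ctrZ m n (a : C) (A : 'M[C]_(m, n)) : ctr (a *: A) = a^* *: ctr A.
Proof. by apply/matrixP => i j; rewrite !(ctrE, mxE) rmorphM. Qed.

Lemma ctr0 m n : ctr (0 : 'M[C]_(m, n)) = 0.
Proof. by apply/matrixP => i j; rewrite !(ctrE, mxE) rmorph0. Qed.

Lemma ctr1 n : ctr (1%:M : 'M[C]_n) = 1%:M.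
Proof. by apply/matrixP => i j; rewrite !(ctrE, mxE) rmorph_nat eq_sym. Qed.

Lemma ctr_col_mx m1 m2 n (A : 'M[C]_(m1, n)) (B : 'M[C]_(m2, n)) :
  ctr (col_mx A B) = row_mx (ctr A) (ctr B).
Proof. by rewrite /ctr map_col_mx tr_col_mx. Qed.

Lemma ctr_row_mx m n1 n2 (A : 'M[C]_(m, n1)) (B : 'M[C]_(m, n2)) :
  ctr (row_mx A B) = col_mx (ctr A) (ctr B).
Proof. by rewrite /ctr map_row_mx tr_row_mx. Qed.

Lemma ctr_block_mx m1 m2 n1 n2 (A : 'M[C]_(m1, n1)) (B : 'M[C]_(m1, n2))
    (D : 'M[C]_(m2, n1)) (E : 'M[C]_(m2, n2)) :
  ctr (block_mx A B D E) = block_mx (ctr A) (ctr D) (ctr B) (ctr E).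
Proof. by rewrite /ctr map_block_mx tr_block_mx. Qed.

Definition sform n (A : 'M[C]_n) (x y : 'cV[C]_n) : C := (ctr x *m A *m y) 0 0.

Lemma sformDl n (A : 'M[C]_n) x y z :
  sform A (x + y) z = sform A x z + sform A y z.
Proof. by rewrite /sform ctrD mulmxDl mulmxDl mxE. Qed.

Lemma sformDr n (A : 'M[C]_n) x y z :
  sform A z (x + y) = sform A z x + sform A z y.
Proof. by rewrite /sform mulmxDr mxE. Qed.

Lemma sformZl n (A : 'M[C]_n) a x y : sform A (a *: x) y = a^* * sform A x y.
Proof. by rewrite /sform ctrZ -scalemxAl -scalemxAl mxE. Qed.

Lemma sformZr n (A : 'M[C]_n) a x y : sform A x (a *: y) = a * sform A x y.
Proof. by rewrite /sform -scalemxAr mxE. Qed.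

Lemma sformC n (A : 'M[C]_n) x y : ctr A = A -> sform A y x = (sform A x y)^*.
Proof. by move=> hA; rewrite /sform -ctrE !ctrM ctrK hA mulmxA. Qed.

Definition qform n (A : 'M[C]_n) (v : 'cV[C]_n) : C := sform A v v.

Definition sqnorm n (v : 'cV[C]_n) : C := (ctr v *m v) 0 0.

Lemma sqnormE n (v : 'cV[C]_n) : sqnorm v = \sum_i `|v i 0| ^+ 2.
Proof.
by rewrite /sqnorm mxE; apply: eq_bigr => i _; rewrite ctrE mulrC -normCK.
Qed.

Lemma sqnorm_ge0 n (v : 'cV[C]_n) : 0 <= sqnorm v.
Proof. by rewrite sqnormE; apply: sumr_ge0 => i _; rewrite exprn_ge0. Qed.

Lemma sqnorm_eq0 n (v : 'cV[C]_n) : sqnorm v = 0 -> v = 0.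
Proof.
rewrite sqnormE => /eqP; rewrite psumr_eq0; last by move=> i _; rewrite exprn_ge0.
move=> /allP h; apply/colP => i; rewrite mxE; apply/eqP.
by have := h i (mem_index_enum i); rewrite /= expf_eq0 /= normr_eq0.
Qed.

Lemma qform_gram m n (B : 'M[C]_(m, n)) (A : 'M[C]_m) v :
  qform (ctr B *m A *m B) v = qform A (B *m v).
Proof. by rewrite /qform /sform ctrM !mulmxA. Qed.

Lemma qform_gram1 m n (B : 'M[C]_(m, n)) v :
  qform (ctr B *m B) v = sqnorm (B *m v).
Proof. by rewrite /qform /sform /sqnorm ctrM !mulmxA. Qed.

Lemma qformD n (A B : 'M[C]_n) v : qform (A + B) v = qform A v + qform B v.
Proof. by rewrite /qform /sform mulmxDr mulmxDl mxE. Qed.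

Lemma qformN n (A : 'M[C]_n) v : qform (- A) v = - qform A v.
Proof. by rewrite /qform /sform mulmxN mulNmx mxE. Qed.

Lemma qformB n (A B : 'M[C]_n) v : qform (A - B) v = qform A v - qform B v.
Proof. by rewrite qformD qformN. Qed.

Lemma qformZ n (a : C) (A : 'M[C]_n) v : qform (a *: A) v = a * qform A v.
Proof. by rewrite /qform /sform -scalemxAr -scalemxAl mxE. Qed.

Lemma qform_real n (A : 'M[C]_n) v : ctr A = A -> qform A v \is Num.real.
Proof. by move=> hA; rewrite CrealE /qform -sformC. Qed.

Lemma qformZr n (A : 'M[C]_n) (a : C) v : qform A (a *: v) = `|a| ^+ 2 * qform A v.
Proof. by rewrite /qform sformZl sformZr mulrA normCK [a * _]mulrC. Qed.

Lemma qformD_parallelogram n (A : 'M[C]_n) x y :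
  qform A (x - y) + qform A (x + y) = 2 * (qform A x + qform A y).
Proof.
rewrite -scaleN1r /qform !sformDl !sformDr !sformZl !sformZr rmorphN1.
exact: parallelogram_identity.
Qed.

Lemma qformDv n (A : 'M[C]_n) x y : ctr A = A ->
  qform A (x + y) = qform A x + sform A x y + (sform A x y)^* + qform A y.
Proof.
by move=> hA; rewrite /qform sformDl !sformDr (sformC _ y hA) !addrA.
Qed.

(** Polarisation lets matrix entries be recovered from quadratic forms, so that convergence of a
    matrix series reduces to convergence of scalar series. *)
Lemma sform_polar n (A : 'M[C]_n) x y :
  sform A x y =
  2^-1 * (qform A (x + y) - qform A x - qform A y
          - 'i * (qform A (x + 'i *: y) - qform A x - qform A y)).
Proof.
rewrite /qform !sformDl !sformDr !sformZl !sformZr conjCi.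
by apply: polar_identity; rewrite -expr2 sqrCi.
Qed.

End ConjugateTranspose.

(** * The matrices j, K and C_k *)

Section SignatureForms.
Variables (R : realType) (p : nat).
Local Notation C := (CC R).
Local Notation jm := (jm R p).
Local Notation Jm := (Jm R p).
Local Notation Km := (Km R p).

Lemma jm_col_mx n (x y : 'M[C]_(p, n)) : jm *m col_mx x y = col_mx x (- y).
Proof. by rewrite mul_block_col !mul0mx mulNmx !mul1mx addr0 add0r. Qed.

Lemma Jm_col_mx n (x y : 'M[C]_(p, n)) : Jm *m col_mx x y = col_mx y x.
Proof. by rewrite mul_block_col !mul0mx !mul1mx addr0 add0r. Qed.

Lemma ctr_jm : ctr jm = jm.
Proof. by rewrite ctr_block_mx ctrN !ctr0 !ctr1. Qed.

Lemma jm_jm : jm *m jm = 1%:M.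
Proof.
by rewrite mulmx_block !(mulmx0, mul0mx, mulNmx, mulmxN, oppr0, mul1mx, opprK, addr0, add0r)
           -scalar_mx_block.
Qed.

Lemma qform_jm (x y : 'cV[C]_p) : qform jm (col_mx x y) = sqnorm x - sqnorm y.
Proof.
rewrite /qform /sform -mulmxA jm_col_mx ctr_col_mx mul_row_col mulmxN.
by rewrite mxE [X in _ + X]mxE.
Qed.

Lemma sqrtC2V_sqr : (sqrtC 2 : C)^-1 * (sqrtC 2)^-1 = 2^-1.
Proof. by rewrite -invfM -expr2 sqrtCK. Qed.

Lemma conj_sqrtC2V : ((sqrtC 2 : C)^-1)^* = (sqrtC 2)^-1.
Proof. by apply/conj_Creal/ger0_real; rewrite invr_ge0 sqrtC_ge0. Qed.

Lemma half_twice n (A : 'M[C]_n) : 2^-1 *: (A + A) = A.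
Proof. by rewrite -[A + A]mulr2n -[A *+ 2]scaler_nat scalerA mulVf ?pnatr_eq0// scale1r. Qed.

Lemma Km_ctr : Km *m ctr Km = 1%:M.
Proof.
rewrite /Km ctrZ conj_sqrtC2V ctr_block_mx ctrN !ctr1 -scalemxAl -scalemxAr.
rewrite scalerA sqrtC2V_sqr mulmx_block !(mulmxN, mulNmx) !mul1mx !opprK subrr.
by rewrite scale_block_mx half_twice scaler0 -scalar_mx_block.
Qed.

Lemma ctr_Km : ctr Km *m Km = 1%:M.
Proof. exact: mulmx1C Km_ctr. Qed.

(** This intertwining carries the normalisation of [beta k] with respect to [Jm] over to
    [beta k *m Km] with respect to [jm]. *)
Lemma Km_jm : Km *m jm = Jm *m Km.
Proof.
rewrite /Km -scalemxAl -scalemxAr !mulmx_block.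
by rewrite !(mulmxN, mulNmx, mulmx0, mul0mx, mulmx1, oppr0, opprK, addr0, add0r).
Qed.

Lemma jm_ctr_Km : jm *m ctr Km = ctr Km *m Jm.
Proof.
by rewrite -[LHS]mul1mx -ctr_Km -mulmxA [Km *m _]mulmxA Km_jm -!mulmxA Km_ctr mulmx1.
Qed.

(** If [x *m a = 0], evaluating both sides of the hypothesis at [x] gives |x|^2 + |x b|^2 = 0, so
    the left kernel of [a] is trivial. *)
Lemma unitmx_gram (n : nat) (a : 'M[C]_p) (b : 'M[C]_(p, n)) :
  a *m ctr a = 1%:M + b *m ctr b -> a \in unitmx.
Proof.
move=> h; rewrite -row_free_unit; apply: inj_row_free => x xa.
have e : sqnorm (ctr x) + sqnorm (ctr b *m ctr x) = 0.
  transitivity ((x *m (a *m ctr a) *m ctr x) 0 0).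
    rewrite h mulmxDr mulmx1 mulmxDl mxE /sqnorm !ctrM !ctrK.
    by rewrite !mulmxA.
  by rewrite !mulmxA xa !mul0mx mxE.
have := @sqnorm_eq0 _ _ (ctr x).
move/eqP: e; rewrite paddr_eq0 ?sqnorm_ge0// => /andP[/eqP e _] /(_ e) x0.
by rewrite -[x]ctrK x0 ctr0.
Qed.

(* The parametrisation solves [a u1 + b u2 = 0] with [u1 = a^* h], [h = - b w]. *)
Lemma ker_row_mx_param n (a : 'M[C]_p) (b : 'M[C]_(p, n)) u1 u2 :
  a *m ctr a = 1%:M + b *m ctr b -> a *m u1 + b *m u2 = 0 ->
  exists w : 'cV[C]_n,
    u1 = - (ctr a *m (b *m w)) /\ u2 = w + ctr b *m (b *m w).
Proof.
move=> h u0; have ua := unitmx_gram h.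
have uca : ctr a \in unitmx by rewrite unitmx_tr map_unitmx.
pose k := invmx (ctr a) *m u1.
have u1E : u1 = ctr a *m k by rewrite mulKVmx.
(* Replacing [a *m ctr a] by [1%:M + b *m ctr b] in [a *m ctr a *m k + b *m u2 = 0] yields this
   fixed-point equation, which dictates the witness [w]. *)
have kE : k = - (b *m (u2 + ctr b *m k)).
  apply/eqP; rewrite -subr_eq0 opprK mulmxDr addrCA mulmxA -[X in _ + (X + _)]mul1mx.
  by rewrite -mulmxDl -h addrC -mulmxA -u1E u0.
exists (u2 + ctr b *m k); split; first by rewrite -mulmxN -kE.
by rewrite -[b *m _]opprK -kE mulmxN addrK.
Qed.

(** With y = b w, the first norm is |w|^2 + 2|y|^2 + |b^* y|^2 and the second is |y|^2 + |b^* y|^2.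
    Thus the form of [jm] is negative definite on the kernel of [row_mx a b]. *)
Lemma sqnorm_ker_row_mx n (a : 'M[C]_p) (b : 'M[C]_(p, n)) (w : 'cV[C]_n) :
  a *m ctr a = 1%:M + b *m ctr b ->
  sqnorm (w + ctr b *m (b *m w)) - sqnorm (- (ctr a *m (b *m w)))
  = sqnorm w + sqnorm (b *m w).
Proof.
move=> h; set y := b *m w.
have -> : sqnorm (- (ctr a *m y)) = sqnorm y + sqnorm (ctr b *m y).
  rewrite /sqnorm ctrN mulNmx mulmxN opprK !ctrM !ctrK -!mulmxA (mulmxA a) h.
  by rewrite mulmxDl mul1mx !mulmxDr mxE !mulmxA.
rewrite {1}/sqnorm ctrD mulmxDl !mulmxDr ctrM ctrK -!mulmxA.
rewrite (mulmxA (ctr w)) -ctrM -/y.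
have mxD00 (A B : 'M[C]_1) : (A + B) 0 0 = A 0 0 + B 0 0 by rewrite mxE.
rewrite mxD00 mxD00 mxD00 (mulmxA (ctr y)) (_ : ctr y *m b = ctr (ctr b *m y)).
  by rewrite -!/(sqnorm _) addrK.
by rewrite ctrM ctrK.
Qed.

(** * The matrices C_k: j-unitarity, positivity and comparison with j *)

Variable beta : nat -> 'M[C]_(p, p + p).
Hypothesis betaJ : forall k, beta k *m Jm *m ctr (beta k) = 1%:M.
Local Notation Ck := (Ck beta).

Lemma CkE k : Ck k = 2 *: (ctr (beta k *m Km) *m (beta k *m Km)) - jm.
Proof. by rewrite /Defs.Ck ctrM !mulmxA. Qed.

Lemma betaK_jm k : (beta k *m Km) *m jm *m ctr (beta k *m Km) = 1%:M.
Proof.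
rewrite ctrM -!mulmxA (mulmxA Km jm) Km_jm !mulmxA.
by rewrite -(mulmxA _ Km) Km_ctr mulmx1 betaJ.
Qed.

Lemma ctr_Ck k : ctr (Ck k) = Ck k.
Proof. by rewrite CkE ctrD ctrN ctrZ ctr_jm ctrM ctrK rmorph_nat. Qed.

(** For g = [beta k *m Km], the matrix P = g^* g j is idempotent because g j g^* = I. Hence C_k j =
    2P - I is an involution. *)
Lemma Ck_jm_Ck k : Ck k *m jm *m Ck k = jm.
Proof.
have := betaK_jm k; rewrite CkE; move: (beta k *m Km) => g h.
have gjg : ctr g *m g *m jm *m (ctr g *m g) = ctr g *m g.
  by have := congr1 (fun M => ctr g *m M *m g) h; rewrite mulmx1 !mulmxA.
rewrite mulmxBl mulmxBl mulmxBr mulmxBr -!scalemxAl -!scalemxAr gjg.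
rewrite -(mulmxA (ctr g *m g) jm) jm_jm mulmx1 !mul1mx.
by rewrite [2 *: (2 *: _)]scaler_nat mulr2n opprB addrK addrC subrK.
Qed.

(** Split [v] j-orthogonally into a vector in the range of j g^*, where the form of j is |g v|^2,
    and a vector of ker g, where it is [- d]. The form of C_k = 2 g^* g - j only flips the sign of
    the second part, which gives at once C_k >= j and the definiteness of C_k. *)
Lemma qform_Ck k v : exists d : C,
  [/\ 0 <= d, qform (Ck k) v = sqnorm (beta k *m Km *m v) + d,
      qform jm v = sqnorm (beta k *m Km *m v) - d &
      beta k *m Km *m v = 0 -> d = 0 -> v = 0].
Proof.
have h := betaK_jm k.
suff [d [d0 jd dv]] : exists d : C, [/\ 0 <= d,
    qform jm v = sqnorm (beta k *m Km *m v) - d &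
    beta k *m Km *m v = 0 -> d = 0 -> v = 0].
  exists d; split=> //; rewrite CkE qformB qformZ qform_gram1 jd opprB.
  by rewrite mulr_natl mulr2n addrA addrAC addrK addrC.
set g := beta k *m Km in h *.
pose a := lsubmx g; pose b := rsubmx g; pose x := g *m v.
have gE : g = row_mx a b by rewrite hsubmxK.
have ab : a *m ctr a = 1%:M + b *m ctr b.
  apply/eqP; rewrite -subr_eq -h gE ctr_row_mx -mulmxA jm_col_mx mul_row_col.
  by rewrite mulmxN.
(* The j-orthogonal projection of [v] onto ker g. *)
pose u := v - jm *m (ctr g *m x).
have gu : g *m u = 0 by rewrite mulmxBr !mulmxA h mul1mx subrr.
have vE : v = jm *m (ctr g *m x) + u by rewrite addrC subrK.
have [w [u1 u2]] : exists w, usubmx u = - (ctr a *m (b *m w)) /\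
    dsubmx u = w + ctr b *m (b *m w).
  apply: ker_row_mx_param => //; rewrite -mul_row_col -gE vsubmxK.
  exact: gu.
exists (sqnorm w + sqnorm (b *m w)); split.
- by rewrite addr_ge0 ?sqnorm_ge0.
- rewrite -(sqnorm_ker_row_mx w ab) -u1 -u2 opprB -qform_jm vsubmxK.
  have s0 : sform jm (jm *m (ctr g *m x)) u = 0.
    rewrite /sform ctrM (ctrM (ctr g)) ctrK ctr_jm -(mulmxA _ jm jm) jm_jm mulmx1 -mulmxA gu.
    by rewrite mulmx0 mxE.
  have -> : qform jm v = qform jm (jm *m (ctr g *m x) + u) by rewrite -vE.
  rewrite (qformDv _ _ ctr_jm) s0 rmorph0.
  rewrite !addr0; congr (_ + _).
  rewrite -qform_gram ctr_jm jm_jm mul1mx -qform_gram.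
  by rewrite ctrK h /qform /sform mulmx1.
- rewrite -/x => x0 /eqP; rewrite paddr_eq0 ?sqnorm_ge0// => /andP[/eqP w0 _].
  rewrite vE x0 !mulmx0 add0r -(vsubmxK u) u1 u2 (sqnorm_eq0 w0).
  by rewrite !mulmx0 addr0 oppr0 col_mx0.
Qed.

Lemma jm_le_Ck k v : qform jm v <= qform (Ck k) v.
Proof.
have [d [d0 -> -> _]] := qform_Ck k v.
by rewrite lerD2l (le_trans _ d0)// oppr_le0.
Qed.

Lemma Ck_ge0 k v : 0 <= qform (Ck k) v.
Proof.
have [d [d0 -> _ _]] := qform_Ck k v.
by rewrite addr_ge0 ?sqnorm_ge0.
Qed.

Lemma Ck_definite k v : qform (Ck k) v = 0 -> v = 0.
Proof.
have [d [d0 -> _ dv]] := qform_Ck k v.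
move/eqP; rewrite paddr_eq0 ?sqnorm_ge0// => /andP[/eqP/sqnorm_eq0 x0 /eqP].
exact: dv.
Qed.

End SignatureForms.

(** * Energy identity *)

Lemma energy_step_identity (F : comPzRingType) (a b e e' n : F) :
  a + - e * b + - e' * b + n * a = (1 + n) * a - (e + e') * b.
Proof. by ring. Qed.

Lemma energy_step_combination (F : comPzRingType) (q qk n s a b : F) :
  q * (1 + n) = 1 ->
  q * qk * ((1 + n) * a - s * b) = qk * a + - (q * s) * (qk * b).
Proof.
move=> h; rewrite mulrBr mulrA [q * qk]mulrC -[qk * q * _]mulrA h mulr1.
by congr (_ + _); ring.
Qed.

(** As [s] is nonnegative, [q * d] is at most 2(qa + qb). Two bounds by [c / 4] therefore push it
    strictly below [c]. *)
Lemma parallelogram_contradiction (F : numFieldType) (q a b d s c : F) : 0 <= q ->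
  0 <= s -> d + s = 2 * (a + b) -> c <= q * d -> q * a < c / 4 -> q * b < c / 4 ->
  False.
Proof.
move=> q0 s0 ds cd ac bc; suff : c < c by rewrite ltxx.
have cE : c = 2 * (c / 4 + c / 4) by field.
rewrite [ltRHS]cE; apply: (@le_lt_trans _ _ (q * (d + s))).
  by rewrite (le_trans cd)// ler_wpM2l// lerDl.
by rewrite ds mulrCA ltr_pM2l// mulrDr ltrD.
Qed.

Lemma imaginary_part_identity (F : numFieldType) (i l l' : F) : l != 0 -> l' != 0 ->
  i / l + - i / l' = 2 * (i * (l' - l) / 2) / (l * l').
Proof. by move=> l0 l'0; field; rewrite l0 l'0. Qed.

Lemma qf_identity (F : fieldType) (n : F) : n != 0 -> n + 1 != 0 ->
  n / (n + 1) * (1 + n^-1) = 1.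
Proof. by move=> n0 n1; field; rewrite n0 n1. Qed.

Section EnergyIdentity.
Variables (R : realType) (p : nat).
Local Notation C := (CC R).
Local Notation jm := (jm R p).
Local Notation Jm := (Jm R p).
Local Notation Km := (Km R p).
Variable beta : nat -> 'M[C]_(p, p + p).
Hypothesis betaJ : forall k, beta k *m Jm *m ctr (beta k) = 1%:M.
Local Notation Ck := (Ck beta).
Local Notation Wk := (Wk beta).

Lemma WkS k (l : C) :
  Wk k.+1 l = (1%:M - ('i / l) *: (jm *m Ck k)) *m Wk k l.
Proof. by rewrite mulmxBl mul1mx -scalemxAl. Qed.

(** In the expansion of the form of j on x - e j C_k x, the quadratic term is |e|^2 C_k j C_k =
    |e|^2 j and the cross terms are multiples of C_k. *)
Lemma qform_jm_WkS k (l : C) v : let e := 'i / l in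
  qform jm (Wk k.+1 l *m v) =
  (1 + `|e| ^+ 2) * qform jm (Wk k l *m v) - (e + e^*) * qform (Ck k) (Wk k l *m v).
Proof.
move=> e; rewrite WkS -/e -mulmxA; move: (Wk k l *m v) => x.
rewrite mulmxBl mul1mx -scalemxAl -mulmxA -[- (e *: _)]scaleNr qformDv ?ctr_jm//.
rewrite qformZr normrN -(qform_gram jm) ctr_jm jm_jm mul1mx -qform_gram ctr_Ck.
rewrite Ck_jm_Ck// sformZr.
have -> : sform jm x (jm *m (Ck k *m x)) = qform (Ck k) x.
  by rewrite /qform /sform -mulmxA (mulmxA jm) jm_jm mul1mx mulmxA.
have /conj_Creal qr : qform (Ck k) x \is Num.real by rewrite qform_real ?ctr_Ck.
rewrite rmorphM /= qr rmorphN /=; exact: energy_step_identity.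
Qed.

(** For nonzero [l] this is -2 Im(l) / (|l|^2 + 1), the factor linking the energy increment to the
    Weyl term. *)
Definition growth_rate (l : C) : C := - (qf l * ('i / l + ('i / l)^*)).

Lemma lhp_neq0 (l : C) : lhp l -> l != 0.
Proof. by rewrite /lhp /=; apply: contraTneq => ->; rewrite raddf0 ltxx. Qed.

Lemma qf_gt0 (l : C) : l != 0 -> 0 < qf l.
Proof.
move=> l0; rewrite /qf divr_gt0 ?exprn_gt0 ?normr_gt0//.
Qed.

Lemma growth_rate_gt0 (l : C) : lhp l -> 0 < growth_rate l.
Proof.
move=> hl; have l0 := lhp_neq0 hl; have lc0 : l^* != 0 by rewrite conjC_eq0.
have e2 : 'i / l + ('i / l)^* = 2 * 'Im l / `|l| ^+ 2.
  rewrite ImE normCK rmorphM /= fmorphV /= conjCi.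
  exact: imaginary_part_identity.
rewrite /growth_rate e2 -mulrN mulr_gt0 ?qf_gt0// oppr_gt0.
rewrite pmulr_llt0 ?pmulr_rlt0 ?ltr0n ?invr_gt0 ?exprn_gt0 ?normr_gt0//.
Qed.

(** This is why the weight is q: it cancels the factor 1 + |i/l|^2 that each step puts on the old
    energy, so that the weighted energies telescope. *)
Lemma qf_normi (l : C) : l != 0 -> qf l * (1 + `|'i / l| ^+ 2) = 1.
Proof.
move=> l0; rewrite normrM normCi mul1r normfV exprVn /qf.
apply: qf_identity; first by rewrite expf_neq0 ?normr_eq0.
by rewrite gt_eqF// ltr_wpDl ?exprn_ge0.
Qed.

Lemma energy_step k (l : C) v : lhp l ->
  qf l ^+ k.+1 * qform jm (Wk k.+1 l *m v) =
  qf l ^+ k * qform jm (Wk k l *m v)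
  + growth_rate l * (qf l ^+ k * qform (Ck k) (Wk k l *m v)).
Proof.
move=> hl; rewrite qform_jm_WkS exprS; apply: energy_step_combination.
by rewrite qf_normi ?lhp_neq0.
Qed.

Lemma energy_sum n (l : C) v : lhp l ->
  growth_rate l * (\sum_(k < n) qf l ^+ k * qform (Ck k) (Wk k l *m v)) =
  qf l ^+ n * qform jm (Wk n l *m v) - qform jm v.
Proof.
move=> hl; elim: n => [|n IH].
  by rewrite big_ord0 mulr0 expr0 mul1r /= mul1mx subrr.
by rewrite big_ord_recr /= mulrDr IH energy_step// addrAC.
Qed.

(** Starting from zero energy, the energy at [k.+1] is [growth_rate l] times a sum of nonnegative
    terms. It therefore dominates the term of index 0 and is itself dominated through C_k >= j. *)
Lemma neutral_bound k (l : C) f : lhp l -> qform jm f = 0 ->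
  growth_rate l * qform (Ck 0) f
  <= qf l ^+ k.+1 * qform (Ck k.+1) (Wk k.+1 l *m f).
Proof.
move=> hl f0; have q0 := qf_gt0 (lhp_neq0 hl).
apply: (@le_trans _ _ (qf l ^+ k.+1 * qform jm (Wk k.+1 l *m f))); last first.
  by rewrite ler_wpM2l ?jm_le_Ck// exprn_ge0// ltW.
rewrite -[leRHS]subr0 -f0 -energy_sum// ler_pM2l ?growth_rate_gt0//.
rewrite big_ord_recl /= expr0 mul1r mul1mx lerDl sumr_ge0// => i _.
by rewrite mulr_ge0 ?exprn_ge0 ?Ck_ge0// ltW.
Qed.

(** * Weyl columns: bounds on partial sums and pointwise uniqueness *)

Definition weyl_col (F : 'M[C]_p) : 'M[C]_(p + p, p) :=
  ctr Km *m col_mx (- 'i *: F) 1%:M.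

Lemma qform_weyl_term phi (l : C) k v :
  qform (weyl_term beta phi l k) v
  = qf l ^+ k * qform (Ck k) (Wk k l *m (weyl_col (phi l) *m v)).
Proof.
rewrite mulmxA -qform_gram -qformZ; congr (qform _ _).
rewrite /weyl_term /weyl_col -scalemxAr -scalemxAl; congr (_ *: _).
rewrite !ctrM ctrK ctr_col_mx ctr1 [ctr (- 'i *: _)]ctrZ.
by rewrite rmorphN /= conjCi opprK !mulmxA.
Qed.

Lemma weyl_term_ge0 phi (l : C) k v : lhp l -> 0 <= qform (weyl_term beta phi l k) v.
Proof.
move=> hl; rewrite qform_weyl_term mulr_ge0 ?exprn_ge0 ?Ck_ge0//.
exact/ltW/qf_gt0/lhp_neq0.
Qed.

Lemma qform_sum n m (A : 'I_n -> 'M[C]_m) v :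
  qform (\sum_k A k) v = \sum_k qform (A k) v.
Proof.
elim/big_rec2: _ => [|k x B _ <-]; last by rewrite qformD.
by rewrite /qform /sform mulmx0 mul0mx mxE.
Qed.

Lemma weyl_sum_le n phi (l : C) v : lhp l ->
  qform jm (Wk n l *m (weyl_col (phi l) *m v)) <= 0 ->
  qform (\sum_(k < n) weyl_term beta phi l k) v
  <= - qform jm (weyl_col (phi l) *m v) / growth_rate l.
Proof.
move=> hl hn; have g0 := growth_rate_gt0 hl.
rewrite qform_sum ler_pdivlMr// mulrC.
under eq_bigr do rewrite qform_weyl_term.
rewrite energy_sum// gerDr pmulr_rle0// exprn_gt0//.
exact/qf_gt0/lhp_neq0.
Qed.

(** Conjugation turns i / conj(l) into -i/l, so one step contributes (I - e j C_k) j (I + e C_k j)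
    with e = i/l. The linear terms cancel and C_k j C_k = j leaves (1 - e^2) j. *)
Lemma Wk_reflection k (l : C) : exists s : C,
  Wk k l *m jm *m ctr (Wk k (conjc l)) = s *: jm.
Proof.
elim: k => [|k [s IH]]; first by exists 1; rewrite ctr1 mul1mx mulmx1 scale1r.
exists (s * (1 - ('i / l) ^+ 2)).
rewrite !WkS ctrM; set A := _ - _; set B := _ - _.
rewrite -!mulmxA (mulmxA jm) (mulmxA (Wk k l)) (mulmxA (Wk k l)) IH.
rewrite -scalemxAl -scalemxAr -scalerA; congr (_ *: _).
rewrite /A /B ctrD ctrN ctr1 ctrZ ctrM ctr_Ck ctr_jm; set e := 'i / l.
have -> : ('i / conjc l)^* = - e.
  by rewrite rmorphM /= fmorphV /= conjCi -/(_^*) conjCK mulNr.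
rewrite scaleNr opprK mulmxBl mul1mx mulmxDr mulmx1.
have jCj : jm *m (Ck k *m jm) = jm *m Ck k *m jm by rewrite mulmxA.
rewrite -scalemxAr mulmxDr -!scalemxAl -scalemxAr.
have -> : jm *m Ck k *m (jm *m (Ck k *m jm)) = jm.
  by rewrite -!mulmxA (mulmxA (Ck k) jm) (mulmxA (_ *m jm)) Ck_jm_Ck// jm_jm mulmx1.
by rewrite jCj scalerA -expr2 opprD addrA addrK scalerBl scale1r.
Qed.

Lemma linear_fractional_nonpos N (z : C) (Rz Qz F : 'M[C]_p) v :
  let G := calW11 beta N z *m Rz + calW12 beta N z *m Qz in
  psd (ctr Qz *m Qz - ctr Rz *m Rz) -> G \in unitmx ->
  F = 'i *: ((calW21 beta N z *m Rz + calW22 beta N z *m Qz) *m invmx G) ->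
  qform jm (Wk N.+1 z *m (weyl_col F *m v)) <= 0.
Proof.
move=> G hpsd uG FE.
set W := Wk N.+1 z; set W' := Wk N.+1 (conjc z).
have [s hs] := Wk_reflection N.+1 z; rewrite -/W -/W' in hs.
(* The linear fractional formula is read projectively: the two block rows are [G] and
   [- 'i *: F *m G]. *)
have h1 : calW beta N z *m col_mx Rz Qz = col_mx 1%:M (- 'i *: F) *m G.
  rewrite -[calW _ _ _]submxK mul_block_col -/(calW11 _ _ _) -/(calW12 _ _ _).
  rewrite -/(calW21 _ _ _) -/(calW22 _ _ _) -/G mul_col_mx mul1mx; congr col_mx.
  rewrite FE scalerA mulNr -expr2 sqrCi opprK scale1r -mulmxA mulVmx//.
  by rewrite mulmx1.
have h2 : ctr W' *m col_mx Rz Qz = ctr Km *m (col_mx 1%:M (- 'i *: F) *m G).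
  by rewrite -h1 /calW !mulmxA ctr_Km mul1mx.
(* Moving j across K^* produces J, which swaps the blocks of [h1] into the order used by [weyl_col];
   the reflection identity then removes both [W] and [W']. *)
have h3 : W *m (weyl_col F *m G) = s *: (jm *m col_mx Rz Qz).
  rewrite scalemxAl -hs -!mulmxA h2 (mulmxA jm) jm_ctr_Km -!mulmxA.
  by rewrite (mulmxA Jm) Jm_col_mx.
have -> : W *m (weyl_col F *m v) = s *: (jm *m (col_mx Rz Qz *m (invmx G *m v))).
  have vE : v = G *m (invmx G *m v) by rewrite mulKVmx.
  by rewrite {1}vE (mulmxA (weyl_col F)) (mulmxA W) h3 -scalemxAl mulmxA.
move: (invmx G *m v) => y.
rewrite qformZr -(qform_gram jm) ctr_jm jm_jm mul1mx mul_col_mx qform_jm.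
rewrite mulr_ge0_le0 ?exprn_ge0// subr_le0 -!qform_gram1 -subr_ge0 -qformB.
exact: hpsd.
Qed.

Lemma weyl_point_unique (l : C) (F1 F2 : 'M[C]_p) (v : 'cV[C]_p) : lhp l ->
  (forall e : C, 0 < e -> exists k,
     qf l ^+ k.+1 * qform (Ck k.+1) (Wk k.+1 l *m (weyl_col F1 *m v)) < e /\
     qf l ^+ k.+1 * qform (Ck k.+1) (Wk k.+1 l *m (weyl_col F2 *m v)) < e) ->
  F1 *m v = F2 *m v.
Proof.
move=> hl small; have q0 := qf_gt0 (lhp_neq0 hl).
pose f := weyl_col F1 *m v - weyl_col F2 *m v.
have fE : f = ctr Km *m col_mx (- 'i *: (F1 *m v - F2 *m v)) 0.
  rewrite /f /weyl_col -!mulmxA !mul_col_mx -mulmxBr opp_col_mx add_col_mx.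
  by rewrite [X in col_mx _ X]subrr scalerBr 2!scalemxAl.
(* Conjugated by K, the form of j becomes that of J, which vanishes on vectors with zero lower
   block. *)
have fj : qform jm f = 0.
  rewrite fE -qform_gram ctrK Km_jm -mulmxA Km_ctr mulmx1.
  by rewrite /qform /sform -mulmxA Jm_col_mx ctr_col_mx mul_row_col mulmx0 ctr0
             mul0mx addr0 mxE.
have C0 : qform (Ck 0) f = 0.
  apply/eqP; rewrite eq_le Ck_ge0// andbT.
  rewrite -(pmulr_rle0 _ (growth_rate_gt0 hl)) real_leNgt ?real0//; last first.
    by rewrite ger0_real// mulr_ge0 ?Ck_ge0// ltW// growth_rate_gt0.
  (* The parallelogram law costs a factor 2 and there are two columns, whence the 4; both columns
     must be small at the same index. *)
  apply/negP => c0; have c40 : 0 < growth_rate l * qform (Ck 0) f / 4.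
    by rewrite divr_gt0.
  have [k [k1 k2]] := small _ c40.
  apply: (parallelogram_contradiction _ _ _ (neutral_bound k hl fj) k1 k2).
  - by rewrite exprn_ge0// ltW.
  - exact: (Ck_ge0 betaJ k.+1 (Wk k.+1 l *m (weyl_col F1 *m v + weyl_col F2 *m v))).
  - by rewrite /f mulmxBr mulmxDr qformD_parallelogram.
have := Ck_definite betaJ C0; rewrite fE => /(congr1 (mulmx Km)).
rewrite mulmxA Km_ctr mul1mx mulmx0 => /(congr1 usubmx); rewrite col_mxKu.
rewrite linear0 => /eqP; rewrite scaler_eq0 oppr_eq0 (negPf (neq0Ci _)) /=.
by rewrite subr_eq0 => /eqP.
Qed.

End EnergyIdentity.

(** * Limits in the complex field and of matrices *)

Lemma ge0_dist0_lt (F : numDomainType) (x e : F) : 0 <= x -> `|0 - x| < e -> x < e.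
Proof. by move=> x0; rewrite sub0r normrN ger0_norm. Qed.

Section ComplexLimits.
Variable R : realType.
Local Notation C := (CC R).

Lemma cvg_mx_entries T (F : set_system T) {FF : Filter F} m n
    (f : T -> 'M[C]_(m, n)) (l : 'M[C]_(m, n)) :
  (forall i j, f x i j @[x --> F] --> l i j) -> f x @[x --> F] --> l.
Proof.
move=> fl A [P lP PA].
have h : \forall x \near F, forall i j, P i j (f x i j).
  by apply: filter_forall => i; apply: filter_forall => j; apply: fl; exact: lP.
by apply: filterS h => x Px; exact: PA.
Qed.

Lemma cvg_mx_entry T (F : set_system T) m n
    (f : T -> 'M[C]_(m, n)) (l : 'M[C]_(m, n)) i j :
  f x @[x --> F] --> l -> f x i j @[x --> F] --> l i j.
Proof.
move=> fl; have h := @coord_continuous C m n i j l.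
exact: (cvg_comp f (fun M => M i j) fl h).
Qed.

Lemma cvg_finite_sum T (F : set_system T) {FF : Filter F} n
    (f : 'I_n -> T -> C) (l : 'I_n -> C) :
  (forall i, f i x @[x --> F] --> l i) ->
  (\sum_i f i x) @[x --> F] --> \sum_i l i.
Proof.
elim: n f l => [|n IH] f l fl.
  rewrite big_ord0; under eq_fun do rewrite big_ord0.
  exact: cvg_cst.
rewrite big_ord_recl; under eq_fun do rewrite big_ord_recl.
by apply: cvgD => //; apply: IH => i; exact: fl.
Qed.

Lemma cvg_mulmx T (F : set_system T) {FF : Filter F} m n q
    (f : T -> 'M[C]_(m, n)) (g : T -> 'M[C]_(n, q))
    (a : 'M[C]_(m, n)) (b : 'M[C]_(n, q)) :
  f x @[x --> F] --> a -> g x @[x --> F] --> b ->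
  f x *m g x @[x --> F] --> a *m b.
Proof.
move=> fa gb; apply: cvg_mx_entries => i j.
rewrite mxE; under eq_fun do rewrite mxE.
by apply: cvg_finite_sum => k; apply: cvgM; exact: cvg_mx_entry.
Qed.

Lemma cvg_mx_cst T (F : set_system T) {FF : Filter F} m n (a : 'M[C]_(m, n)) :
  a @[x --> F] --> a.
Proof. by apply: cvg_mx_entries => i j; exact: cvg_cst. Qed.

Lemma cvg_addmx T (F : set_system T) {FF : Filter F} m n
    (f g : T -> 'M[C]_(m, n)) (a b : 'M[C]_(m, n)) :
  f x @[x --> F] --> a -> g x @[x --> F] --> b -> f x + g x @[x --> F] --> a + b.
Proof.
move=> fa gb; apply: cvg_mx_entries => i j.
rewrite mxE; under eq_fun do rewrite mxE.
by apply: cvgD; exact: cvg_mx_entry.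
Qed.

Lemma cvg_scalemx T (F : set_system T) {FF : Filter F} m n
    (f : T -> C) (g : T -> 'M[C]_(m, n)) (a : C) (b : 'M[C]_(m, n)) :
  f x @[x --> F] --> a -> g x @[x --> F] --> b -> f x *: g x @[x --> F] --> a *: b.
Proof.
move=> fa gb; apply: cvg_mx_entries => i j.
rewrite mxE; under eq_fun do rewrite mxE.
by apply: cvgM; [exact: fa | exact: cvg_mx_entry gb].
Qed.

Lemma cvg_ctr T (F : set_system T) {FF : Filter F} m n
    (f : T -> 'M[C]_(m, n)) (a : 'M[C]_(m, n)) :
  f x @[x --> F] --> a -> ctr (f x) @[x --> F] --> ctr a.
Proof.
move=> fa; apply: cvg_mx_entries => i j.
rewrite ctrE; under eq_fun do rewrite ctrE.
have {}fa := @cvg_mx_entry _ _ _ _ _ _ j i fa.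
apply/cvgrPdist_lt => e e0; have /cvgrPdist_lt/(_ _ e0) := fa.
by apply: filterS => x; rewrite -rmorphB norm_conjC.
Qed.

Lemma cvg_qform T (F : set_system T) {FF : Filter F} n (A : T -> 'M[C]_n)
    (f : T -> 'cV[C]_n) (B : 'M[C]_n) (a : 'cV[C]_n) :
  A x @[x --> F] --> B -> f x @[x --> F] --> a ->
  qform (A x) (f x) @[x --> F] --> qform B a.
Proof.
move=> AB fa; apply: (@cvg_mx_entry _ _ _ _ (fun x => ctr (f x) *m A x *m f x)).
by apply: cvg_mulmx => //; apply: cvg_mulmx => //; exact: cvg_ctr.
Qed.

(** The order on complex numbers is partial, so a limit that is real but not nonpositive must be
    positive; a value [g x <= 0] at distance less than [l] from [l] is then impossible. *)
Lemma cvg_real_le0 T (F : set_system T) {FF : ProperFilter F} (g : T -> C) (l : C) :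
  g x @[x --> F] --> l -> l \is Num.real -> (\forall x \near F, g x <= 0) -> l <= 0.
Proof.
move=> gl lr g0; rewrite real_leNgt ?real0//; apply/negP => l0.
have [x [gx]] := filter_ex (filterI g0 (cvgr_dist_lt _ _ gl _ l0)).
rewrite ger0_norm; last by rewrite subr_ge0 (le_trans gx)// ltW.
by rewrite gtrBl => /(le_lt_trans gx); rewrite ltxx.
Qed.

Lemma norm_Im_le (u : C) : `|'Im u| <= `|u|.
Proof.
rewrite ImE !normrM normCi mul1r normfV ler_pdivrMr ?normr_gt0 ?pnatr_eq0//.
by rewrite (le_trans (ler_normB _ _))// norm_conjC normr_nat -mulr2n mulr_natr.
Qed.

Lemma near_lhp (z : C) : lhp z -> \forall w \near z, lhp w.
Proof.
rewrite /lhp /= => hz; have e0 : 0 < - 'Im z by rewrite oppr_gt0.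
have /cvgrPdist_lt/(_ _ e0) : id w @[w --> z] --> z by exact: cvg_id.
 apply: filterS => w /= zw.
have -> : 'Im w = 'Im z - 'Im (z - w) by rewrite raddfB /= opprB addrC subrK.
rewrite -[ltRHS](subrr ('Im z)) ltrD2l (le_lt_trans _ zw)//.
by rewrite (le_trans _ (norm_Im_le _))// -normrN real_ler_norm// rpredN Creal_Im.
Qed.

Lemma norm_real_complex (x : R) : `|(x%:C)%C| = (`|x|%:C)%C.
Proof. by rewrite normc_def /= expr0n addr0 sqrtr_sqr. Qed.

(** Nonnegativity makes all terms and [M] real, so monotone convergence in [R] applies to the real
    parts. *)
Lemma monotone_cvg_complex (u : nat -> C) (M : C) :
  (forall n, 0 <= u n) -> (forall n, u n <= u n.+1) -> (forall n, u n <= M) ->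
  exists l : C, u n @[n --> \oo] --> l.
Proof.
move=> u0 uS uM.
pose r (z : C) : R := complex.Re z.
have rE z : 0 <= z -> z = ((r z)%:C)%C by move=> /ger0_real /RRe_real.
have M0 : 0 <= M by apply: le_trans (u0 0%N) (uM 0%N).
have /cvg_ex [l rl] : cvgn (r \o u).
  apply: nondecreasing_is_cvgn.
    apply/nondecreasing_seqP => n; rewrite -lecR.
    by have := uS n; rewrite {1}(rE _ (u0 n)) {1}(rE _ (u0 n.+1)).
  exists (r M) => _ [n _ <-]; rewrite -lecR.
  by have := uM n; rewrite {1}(rE _ (u0 n)) {1}(rE _ M0).
exists ((l%:C)%C : C); apply/cvgrPdist_lt => e e0.
have er0 : 0 < r e by rewrite -ltcR; have := e0; rewrite {1}(rE _ (ltW e0)).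
have /cvgrPdist_lt/(_ _ er0) := rl; apply: filterS => n.
move=> /= h; rewrite {1}(rE _ (u0 n)) -rmorphB norm_real_complex.
have : ((`|l - r (u n)|)%:C < (r e)%:C)%C by rewrite ltcR.
by rewrite -(rE _ (ltW e0)).
Qed.

(** Each entry is a sesquilinear value on basis vectors, hence by polarisation a fixed combination
    of four convergent quadratic forms. *)
Lemma cvg_mx_of_qform m (S : nat -> 'M[C]_m) :
  (forall v, exists l : C, qform (S n) v @[n --> \oo] --> l) -> cvg (S n @[n --> \oo]).
Proof.
move=> /choice[q Sq].
have SE i j n : S n i j = sform (S n) (delta_mx i 0) (delta_mx j 0).
  rewrite /sform; have -> : ctr (delta_mx i 0) = delta_mx 0 i :> 'rV[C]_m.
    by apply/matrixP => a b; rewrite ctrE !mxE rmorph_nat andbC.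
  by rewrite -rowE -colE !mxE.
pose L i j := let x := delta_mx i 0 in let y := delta_mx j 0 in
  2^-1 * (q (x + y) - q x - q y - 'i * (q (x + 'i *: y) - q x - q y)).
apply/cvg_ex; exists (\matrix_(i, j) L i j).
apply: cvg_mx_entries => i j; rewrite mxE.
under eq_fun do rewrite SE sform_polar.
apply: cvgMr; apply: cvgB.
  by apply: cvgB => //; apply: cvgB.
by apply: cvgMr; apply: cvgB => //; apply: cvgB.
Qed.

End ComplexLimits.

(** * Weyl functions *)

Section WeylFunctions.
Variables (R : realType) (p : nat).
Local Notation C := (CC R).
Local Notation jm := (jm R p).
Local Notation Jm := (Jm R p).
Variable beta : nat -> 'M[C]_(p, p + p).
Hypothesis betaJ : forall k, beta k *m Jm *m ctr (beta k) = 1%:M.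
Local Notation Wk := (Wk beta).

(* Stated along an arbitrary filter: on the carrier [CC R], unification unfolds
   the canonical filter [nbhs z] into balls. *)
Lemma cvg_Wk T (F : set_system T) {FF : Filter F} (f : T -> C) (z : C) k : z != 0 ->
  f x @[x --> F] --> z -> Wk k (f x) @[x --> F] --> Wk k z.
Proof.
move=> z0 fz; elim: k => [|k IH]; first exact: (@cvg_mx_cst R T F FF (p + p) (p + p) 1%:M).
have WE (w : C) : Wk k.+1 w = Wk k w + (- 'i / w) *: (jm *m Ck beta k *m Wk k w).
  by rewrite mulNr scaleNr.
rewrite WE; under eq_fun do rewrite WE.
apply: cvg_addmx; first exact: IH.
apply: cvg_scalemx; last by apply: cvg_mulmx; [exact: cvg_mx_cst | exact: IH].
by apply: cvgM; [exact: cvg_cst | exact: (cvgV z0 fz)].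
Qed.

Lemma cvg_weyl_col T (F : set_system T) {FF : Filter F} (f : T -> 'M[C]_p)
    (a : 'M[C]_p) :
  f x @[x --> F] --> a -> weyl_col (f x) @[x --> F] --> weyl_col a.
Proof.
move=> fa.
(* An affine expression of the column, to which the limits of products and sums apply. *)
have colE (M : 'M[C]_p) : col_mx (- 'i *: M) 1%:M
    = col_mx 1%:M 0 *m (- 'i *: M) + col_mx 0 1%:M :> 'M[C]_(p + p, p).
  by rewrite mul_col_mx mul1mx mul0mx add_col_mx addr0 add0r.
rewrite /weyl_col colE; under eq_fun do rewrite colE.
apply: cvg_mulmx; first exact: cvg_mx_cst.
apply: cvg_addmx; last exact: cvg_mx_cst.
apply: cvg_mulmx; first exact: cvg_mx_cst.
by apply: cvg_scalemx; [exact: cvg_cst | exact: fa].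
Qed.

Lemma cvg_energy T (F : set_system T) {FF : Filter F} (f : T -> C)
    (g : T -> 'M[C]_p) (z : C) (a : 'M[C]_p) k v : z != 0 ->
  f x @[x --> F] --> z -> g x @[x --> F] --> a ->
  qform jm (Wk k (f x) *m (weyl_col (g x) *m v)) @[x --> F]
  --> qform jm (Wk k z *m (weyl_col a *m v)).
Proof.
move=> z0 fz ga; apply: cvg_qform; first exact: cvg_mx_cst.
apply: cvg_mulmx; first exact: cvg_Wk z0 fz.
by apply: cvg_mulmx; [exact: cvg_weyl_col ga | exact: cvg_mx_cst].
Qed.

(** * Existence and uniqueness of the Weyl function *)

Lemma holo_on_cvg (D : set C) (phi : C -> 'M[C]_p) z :
  holo_on D phi -> D z -> phi w @[w --> z] --> phi z.
Proof.
move=> hphi Dz; have /derivable1_diffP := hphi z Dz.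
exact: differentiable_continuous.
Qed.

Lemma inN_energy_nonpos N (phi : C -> 'M[C]_p) (z : C) v : inN beta N phi -> lhp z ->
  qform jm (Wk N.+1 z *m (weyl_col (phi z) *m v)) <= 0.
Proof.
move=> [hol [Rf [Qf [PR [PQ [D [_ _ RQ [_ discD] phiE]]]]]]] zl.
(* The point [z] may be exceptional, so the sign is proved on a punctured neighbourhood avoiding [D]
   and passed to the limit. *)
have idz : id w @[w --> z^'] --> z by move=> A; exact: nbhs_dnbhs.
have phiz : phi w @[w --> z^'] --> phi z.
  by move=> A /(holo_on_cvg hol zl); exact: nbhs_dnbhs.
apply: (cvg_real_le0 (cvg_energy (lhp_neq0 zl) idz phiz)); first by rewrite qform_real ?ctr_jm.
have nl : \forall w \near z^', lhp w by apply: nbhs_dnbhs; exact: near_lhp.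
apply: filterS2 nl (discD z zl) => w wl nD.
have [nPR nPQ uG phiw] := phiE w wl nD.
have [_ hpsd] := RQ w wl nPR nPQ.
exact: linear_fractional_nonpos hpsd uG phiw.
Qed.

Lemma weyl_fun_of_inN (phi : C -> 'M[C]_p) :
  (forall N, inN beta N phi) -> weyl_fun beta phi.
Proof.
move=> hin; split; first by have [] := hin 0%N.
move=> l hl; apply: cvg_mx_of_qform => v.
pose M := - qform jm (weyl_col (phi l) *m v) / growth_rate l.
(* Membership for index n controls the energy of [Wk n.+1], hence the sum of n + 1 terms; shorter
   sums follow from [mono]. *)
have bound n : qform (\sum_(k < n.+1) weyl_term beta phi l k) v <= M.
  by apply: weyl_sum_le => //; exact: inN_energy_nonpos.
have mono n : qform (\sum_(k < n) weyl_term beta phi l k) v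
    <= qform (\sum_(k < n.+1) weyl_term beta phi l k) v.
  by rewrite [in leRHS]big_ord_recr qformD lerDl weyl_term_ge0.
apply: (monotone_cvg_complex _ mono (fun n => le_trans (mono n) (bound n))) => n.
by rewrite qform_sum sumr_ge0// => k _; rewrite weyl_term_ge0.
Qed.

Lemma weyl_term_cvg0 (phi : C -> 'M[C]_p) l v : weyl_fun beta phi -> lhp l ->
  qform (weyl_term beta phi l k) v @[k --> \oo] --> (0 : C).
Proof.
move=> [_ hphi] hl.
have t0 : weyl_term beta phi l k @[k --> \oo] --> (0 : 'M[C]_p).
  by apply: cvg_series_cvg_0; rewrite seriesEord; exact: hphi.
have -> : (0 : C) = qform 0 v by rewrite /qform /sform mulmx0 mul0mx mxE.
by apply: cvg_qform; [exact: t0 | exact: cvg_mx_cst].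
Qed.

Lemma weyl_fun_unique (phi psi : C -> 'M[C]_p) l :
  weyl_fun beta phi -> weyl_fun beta psi -> lhp l -> phi l = psi l.
Proof.
move=> hphi hpsi hl.
suff h (v : 'cV_p) : phi l *m v = psi l *m v.
  apply/matrixP => i j.
  have := congr1 (fun u : 'cV_p => u i 0) (h (delta_mx j 0)).
  by rewrite -!colE !mxE.
apply: (weyl_point_unique betaJ hl) => e e0.
have /cvgrPdist_lt/(_ _ e0) phi0 := weyl_term_cvg0 v hphi hl.
have /cvgrPdist_lt/(_ _ e0) psi0 := weyl_term_cvg0 v hpsi hl.
have [n _ hn] := filterI phi0 psi0.
(* The index is shifted because [weyl_point_unique] asks for small terms at a successor. *)
have [t1 t2] := hn n.+1 (leqnSn n).
exists n; split.
  by have := ge0_dist0_lt (weyl_term_ge0 betaJ phi n.+1 v hl) t1; rewrite qform_weyl_term.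
by have := ge0_dist0_lt (weyl_term_ge0 betaJ psi n.+1 v hl) t2; rewrite qform_weyl_term.
Qed.

End WeylFunctions.

Theorem theorem6p5 (R : realType) (p : nat) (hp : (0 < p)%N)
  (beta : nat -> 'M[CC R]_(p, p + p))
  (hbeta : forall k, beta k *m Jm R p *m ctr (beta k) = 1%:M)
  (phi_inf : CC R -> 'M[CC R]_p)
  (hin : forall N, inN beta N phi_inf)
  (huniq : forall psi, (forall N, inN beta N psi) ->
             forall z : CC R, lhp z -> psi z = phi_inf z) :
  weyl_fun beta phi_inf /\
  (forall phi, weyl_fun beta phi -> forall z : CC R, lhp z -> phi z = phi_inf z).
Proof.
have phi_inf_weyl := weyl_fun_of_inN hbeta hin.
split=> // phi phi_weyl z; exact: weyl_fun_unique.
Qed.
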